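(* Let $\varepsilon,a>0$ be constants and suppose that $h\in C^3(\mathbb{R})$ is an even function. Let $R>0$ be given and suppose that $$\frac{\varepsilon\pi}{2}\max_{|z|\le R+a}\left(|h(z)|\right)\le R\quad\text{and}\quad\frac{\varepsilon\pi}{2}\max_{|z|\le R+a}\left(|h'(z)|\right)<1.$$ Then there exists a $2\pi$-periodic solution $x^{**}$ of the scalar differential equation $$\dot x(t)=-\varepsilon\sin(t)\,h\big(x(t)+a\sin(t)\big),\qquad x(t)\in\mathbb{R},$$ with $x^{**}(0)=-x^{**}(\pi)$ and $\max_{t\in[0,2\pi]}\left(|x^{**}(t)|\right)\le\frac{\varepsilon\pi}{2}\max_{|z|\le R+a}\left(|h(z)|\right)$.
   Context: $C^3(\mathbb{R})$ is the class of three times continuously differentiable real-valued functions on $\mathbb{R}$. A $2\pi$-periodic solution is a solution defined for all $t\ge 0$ and satisfying $x(t+2\pi)=x(t)$ (constant solutions are allowed). *)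

(* Defs.v *)
From Stdlib Require Import Reals Lra Lia.
From Coquelicot Require Import Coquelicot.
Open Scope R_scope.

(* [ex_derive_n f n] only speaks about the last differentiation step of the
   total operator [Derive_n], so every order up to [n] is required. *)
Definition class_C (n : nat) (f : R -> R) : Prop :=
  (forall k : nat, (k <= n)%nat -> forall z : R, ex_derive_n f k z) /\
  (forall z : R, continuous (Derive_n f n) z).

Definition even_function (f : R -> R) : Prop := forall z : R, f (- z) = f z.

Definition is_max_on (D : R -> Prop) (f : R -> R) (m : R) : Prop :=
  (exists z : R, D z /\ f z = m) /\ (forall z : R, D z -> f z <= m).

Definition abs_le (r : R) : R -> Prop := fun z => Rabs z <= r.

Definition closed_itv (b c : R) : R -> Prop := fun t => b <= t <= c.

Definition half_line : R -> Prop := fun t => 0 <= t.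

(* [D_in] is differentiation relative to the half-line: one-sided at [t = 0],
   and values of [x] at negative times play no role. *)
Definition is_solution (F : R -> R -> R) (x : R -> R) : Prop :=
  forall t : R, 0 <= t -> D_in x (fun s => F s (x s)) half_line t.

Definition is_periodic_solution (F : R -> R -> R) (T : R) (x : R -> R) : Prop :=
  is_solution F x /\ (forall t : R, 0 <= t -> x (t + T) = x t).

Definition rhs (eps a : R) (h : R -> R) (t y : R) : R :=
  - eps * sin t * h (y + a * sin t).

Lemma is_max_on_unique (D : R -> Prop) (f : R -> R) (m m' : R) :
  is_max_on D f m -> is_max_on D f m' -> m = m'.
Proof.
intros [[z [Dz <-]] ub] [[z' [Dz' <-]] ub'].
apply Rle_antisym; auto.
Qed.

Lemma is_max_on_itv_ex (b c : R) (f : R -> R) :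
  b <= c -> (forall t, b <= t <= c -> continuous f t) ->
  exists m, is_max_on (closed_itv b c) (fun t => Rabs (f t)) m.
Proof.
intros bc cf.
destruct (continuity_ab_maj (fun t => Rabs (f t)) b c bc) as [z [ub Dz]].
- intros t Dt; apply continuity_pt_filterlim.
  apply (continuous_comp f Rabs); [now apply cf | apply continuous_Rabs].
- exists (Rabs (f z)); split; [now exists z | exact ub].
Qed.

Lemma is_max_on_abs_le_ex (r : R) (f : R -> R) :
  0 <= r -> (forall t, continuous f t) ->
  exists m, is_max_on (abs_le r) (fun t => Rabs (f t)) m.
Proof.
intros r0 cf.
destruct (is_max_on_itv_ex (- r) r f) as [m [[z [Dz fz]] ub]]; [lra | auto |].
exists m; split.
- exists z; split; [now apply Rabs_le | exact fz].
- intros y Dy; apply ub; now apply Rabs_le_between.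
Qed.

(* Main.v *)
Require Import Defs.
From Stdlib Require Import Reals Lra Lia.
From Coquelicot Require Import Coquelicot.
Open Scope R_scope.

(** The idea is to look for a solution that is antiperiodic with half-period
    [PI], that is [x (t + PI) = - x t] for all real [t]: such an [x] is
    [2 * PI]-periodic and satisfies [x 0 = - x PI].  Since [h] is even and [sin]
    is itself antiperiodic, substituting an antiperiodic [y] for [x] in the right
    hand side gives an antiperiodic forcing [f y]
    ([antiperiodic_rhs]).  An antiperiodic continuous function has exactly one
    antiperiodic primitive, which is minus half its integral over
    [t, t + PI] ([is_derive_antiperiodic_primitive],
    [antiperiodic_antiperiodic_primitive]).  So the solutions sought are the
    fixed points of the operator sending [y] to the antiperiodic primitive of
    [f y].

    Taking that primitive costs a factor [PI / 2] in sup norm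
    ([antiperiodic_primitive_bound]), which is where the constants of the theorem
    come from: the image of a function bounded by [r] is bounded by
    [eps * PI / 2 * M0 <= r], and the operator contracts distances by
    [eps * PI / 2 * M1 < 1] thanks to the mean value theorem for [h].  The
    contraction principle ([uniform_contraction_fixed_point]) is applied on the
    set of antiperiodic functions bounded by [eps * PI / 2 * M0] and Lipschitz
    with constant [eps * M0].  The Lipschitz condition stands in for continuity:
    it holds automatically on the image of the operator, and unlike continuity it
    survives pointwise limits, so no argument about uniform limits is needed. *)

(** * The contraction principle in sup norm *)

Lemma is_lim_seq_scal_geom (C q : R) :
  0 <= q < 1 -> is_lim_seq (fun n => C * q ^ n) 0.
Proof.
intros Hq; replace (Finite 0) with (Rbar_mult C 0) by (simpl; f_equal; ring).
apply is_lim_seq_scal_l, is_lim_seq_geom; rewrite Rabs_pos_eq; lra.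
Qed.

Lemma is_lim_seq_0_of_abs_le_geom (e : nat -> R) (C q : R) :
  0 <= q < 1 -> (forall n, Rabs (e n) <= C * q ^ n) -> is_lim_seq e 0.
Proof.
intros Hq He; apply is_lim_seq_abs_0.
apply (is_lim_seq_le_le (fun _ => 0) _ (fun n => C * q ^ n)).
- intros n; split; [apply Rabs_pos | apply He].
- apply is_lim_seq_const.
- now apply is_lim_seq_scal_geom.
Qed.

Lemma is_lim_seq_abs_le (u : nat -> R) (l c d : R) :
  is_lim_seq u l -> (forall n, Rabs (u n - c) <= d) -> Rabs (l - c) <= d.
Proof.
intros Hu Hd.
assert (H : is_lim_seq (fun n => Rabs (u n - c)) (Rabs (l - c))).
{ apply (is_lim_seq_abs _ (Finite (l - c))).
  apply (is_lim_seq_minus' u (fun _ => c)); auto; apply is_lim_seq_const. }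
exact (is_lim_seq_le _ (fun _ => d) _ (Finite d) Hd H (is_lim_seq_const d)).
Qed.

(** The quantification over bounds [d] of [y - z] expresses a contraction in the
    sup norm without naming a supremum. *)
Definition uniform_contraction {X : Type} (q : R) (D : (X -> R) -> Prop)
  (T : (X -> R) -> X -> R) : Prop :=
  forall y z d, D y -> D z -> (forall t, Rabs (y t - z t) <= d) ->
  forall t, Rabs (T y t - T z t) <= q * d.

(** The tail estimate comes without a geometric sum: all iterates lie in [D], so
    any two are within [2 * B] of each other, and applying [T] [n] times to the
    pair of the [p]-th and the initial iterate shrinks that distance by [q ^ n].
    The iterates are therefore uniformly Cauchy, and their limit is fixed. *)
Lemma uniform_contraction_fixed_point (X : Type) (D : (X -> R) -> Prop)
  (T : (X -> R) -> X -> R) (q B : R) (u0 : X -> R) :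
  0 <= q < 1 ->
  uniform_contraction q D T ->
  D u0 -> (forall y, D y -> D (T y)) ->
  (forall y, D y -> forall t, Rabs (y t) <= B) ->
  (forall (u : nat -> X -> R) (l : X -> R), (forall n, D (u n)) ->
     (forall t, is_lim_seq (fun n => u n t) (l t)) -> D l) ->
  exists y, D y /\ forall t, T y t = y t.
Proof.
intros Hq HT D0 DT DB Dlim.
set (u := fun n => Nat.iter n T u0).
assert (Du : forall n, D (u n)).
{ induction n as [|n IH]; [exact D0 | exact (DT _ IH)]. }
assert (Hu : forall n p t, Rabs (u (p + n)%nat t - u n t) <= 2 * B * q ^ n).
{ induction n as [|n IH]; intros p t.
  - rewrite Nat.add_0_r; simpl (q ^ 0).
    eapply Rle_trans; [apply Rabs_triang|]; rewrite Rabs_Ropp.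
    pose proof (DB _ (Du p) t); pose proof (DB _ (Du 0%nat) t); lra.
  - rewrite Nat.add_succ_r.
    replace (2 * B * q ^ S n) with (q * (2 * B * q ^ n)) by (simpl; ring).
    exact (HT _ _ _ (Du (p + n)%nat) (Du n) (IH p) t). }
set (l := fun t => real (Lim_seq (fun n => u n t))).
assert (Hl : forall t, is_lim_seq (fun n => u n t) (l t)).
{ intros t; apply Lim_seq_correct', ex_lim_seq_cauchy_corr.
  pose proof (is_lim_seq_scal_geom (2 * B) q Hq) as Hg.
  intros eps.
  destruct (proj2 (is_lim_seq_spec _ _) Hg (pos_div_2 eps)) as [N HN].
  specialize (HN N (Nat.le_refl N)); simpl in HN.
  apply Rabs_lt_between in HN.
  exists N; intros n m Hn Hm.
  pose proof (Hu N (n - N)%nat t) as An; pose proof (Hu N (m - N)%nat t) as Am.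
  rewrite Nat.sub_add in An, Am by assumption.
  apply Rabs_le_between in An; apply Rabs_le_between in Am.
  apply Rabs_lt_between; lra. }
assert (Dl : D l) by exact (Dlim u l Du Hl).
assert (Hul : forall n t, Rabs (u n t - l t) <= 2 * B * q ^ n).
{ intros n t; rewrite Rabs_minus_sym.
  apply (is_lim_seq_abs_le (fun p => u (p + n)%nat t)).
  - exact (proj1 (is_lim_seq_incr_n (fun k => u k t) n (l t)) (Hl t)).
  - intros p; apply Hu. }
exists l; split; [exact Dl|]; intros t.
(* The shifted iterates [u (S n) = T (u n)] converge both to [T l] and to [l]. *)
assert (HTl : is_lim_seq (fun n => u (S n) t - T l t) 0).
{ apply (is_lim_seq_0_of_abs_le_geom _ (q * (2 * B)) q Hq); intros n.
  rewrite Rmult_assoc; exact (HT _ _ _ (Du n) Dl (Hul n) t). }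
assert (Hll : is_lim_seq (fun n => u (S n) t - T l t) (l t - T l t)).
{ apply (is_lim_seq_minus' _ (fun _ => T l t));
    [exact (proj1 (is_lim_seq_incr_1 _ _) (Hl t)) | apply is_lim_seq_const]. }
apply is_lim_seq_unique in HTl; apply is_lim_seq_unique in Hll.
rewrite HTl in Hll; injection Hll; lra.
Qed.

(** * Lipschitz functions *)

Lemma lipschitz_of_derive_bound (f df : R -> R) (b c K : R) :
  (forall x, Rmin b c <= x <= Rmax b c -> is_derive f x (df x)) ->
  (forall x, Rmin b c <= x <= Rmax b c -> Rabs (df x) <= K) ->
  Rabs (f c - f b) <= K * Rabs (c - b).
Proof.
intros Hf HK.
destruct (MVT_gen f b c df) as [x [Hx ->]].
- intros x Hx; apply Hf; lra.
- intros x Hx; apply continuity_pt_filterlim.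
  apply (ex_derive_continuous (V := R_NormedModule)); eexists; apply Hf, Hx.
- rewrite Rabs_mult; apply Rmult_le_compat_r; [apply Rabs_pos | now apply HK].
Qed.

Definition lipschitz (K : R) (y : R -> R) : Prop :=
  forall s t, Rabs (y t - y s) <= K * Rabs (t - s).

Lemma lipschitz_continuous (K : R) (y : R -> R) (t : R) :
  lipschitz K y -> continuous y t.
Proof.
intros HK P [e HP].
(* [K] may vanish, hence the denominator [Rabs K + 1]. *)
assert (HK1 : 0 < Rabs K + 1) by (pose proof (Rabs_pos K); lra).
assert (He : 0 < e / (Rabs K + 1)) by (apply Rdiv_lt_0_compat; [apply cond_pos | lra]).
exists (mkposreal _ He); intros s Hs.
apply HP.
change (Rabs (s - t) < e / (Rabs K + 1)) in Hs.
change (Rabs (y s - y t) < e).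
apply Rle_lt_trans with (1 := HK t s).
apply Rle_lt_trans with ((Rabs K + 1) * Rabs (s - t)).
- apply Rmult_le_compat_r; [apply Rabs_pos|]; pose proof (Rle_abs K); lra.
- rewrite Rmult_comm; apply Rlt_div_r; lra.
Qed.

Lemma lipschitz_lim (K : R) (u : nat -> R -> R) (l : R -> R) :
  (forall n, lipschitz K (u n)) ->
  (forall t, is_lim_seq (fun n => u n t) (l t)) -> lipschitz K l.
Proof.
intros Hu Hl s t; rewrite <- (Rminus_0_r (l t - l s)).
apply (is_lim_seq_abs_le (fun n => u n t - u n s)).
- apply is_lim_seq_minus'; apply Hl.
- intros n; rewrite Rminus_0_r; apply Hu.
Qed.

(** * Antiperiodic functions and their antiperiodic primitives *)

Definition antiperiodic (p : R) (f : R -> R) : Prop :=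
  forall t, f (t + p) = - f t.

Lemma antiperiodic_lim (p : R) (u : nat -> R -> R) (l : R -> R) :
  (forall n, antiperiodic p (u n)) ->
  (forall t, is_lim_seq (fun n => u n t) (l t)) -> antiperiodic p l.
Proof.
intros Hu Hl t.
assert (H : is_lim_seq (fun n => u n (t + p)) (- l t)).
{ apply (is_lim_seq_ext (fun n => - u n t)).
  - intros n; symmetry; apply Hu.
  - apply (is_lim_seq_opp _ (Finite (l t))), Hl. }
apply is_lim_seq_unique in H.
rewrite (is_lim_seq_unique _ _ (Hl (t + p))) in H; now injection H.
Qed.

(** The primitive of [f] singled out by antiperiodicity: if [x' = f] and
    [x (t + p) = - x t], then integrating [f] from [t] to [t + p] gives
    [- 2 * x t]. *)
Definition antiperiodic_primitive (p : R) (f : R -> R) (t : R) : R :=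
  - / 2 * RInt f t (t + p).

Lemma ex_RInt_of_continuous (f : R -> R) (b c : R) :
  (forall t, continuous f t) -> ex_RInt f b c.
Proof.
intros Hf; apply (ex_RInt_continuous (V := R_CompleteNormedModule)); auto.
Qed.

Lemma is_derive_antiperiodic_primitive (p : R) (f : R -> R) (t : R) :
  (forall s, continuous f s) -> antiperiodic p f ->
  is_derive (antiperiodic_primitive p f) t (f t).
Proof.
intros Hf Hp.
assert (Hd : forall s, is_derive (fun v => RInt f 0 v) s (f s)).
{ intros s; apply (is_derive_RInt f (RInt f 0) 0 s); [|apply Hf].
  apply filter_forall; intros v; apply (RInt_correct (V := R_CompleteNormedModule)), ex_RInt_of_continuous, Hf. }
(* With the moving lower end replaced by [0], the derivative of the primitive is
   [- / 2 * (f (t + p) - f t)], and antiperiodicity turns this into [f t]. *)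
apply (is_derive_ext (fun s => - / 2 * (RInt f 0 (s + p) - RInt f 0 s))).
{ intros s; unfold antiperiodic_primitive; f_equal.
  rewrite <- (RInt_Chasles f 0 s (s + p)) by apply ex_RInt_of_continuous, Hf.
  unfold plus; simpl; ring. }
replace (f t) with (- / 2 * (1 * f (t + p) - f t)) by (rewrite Hp; lra).
apply is_derive_scal.
apply (is_derive_minus (fun s => RInt f 0 (s + p)) (RInt f 0)); [|apply Hd].
apply (is_derive_comp (RInt f 0) (fun s => s + p)); [apply Hd|].
auto_derive; auto.
Qed.

Lemma antiperiodic_antiperiodic_primitive (p : R) (f : R -> R) :
  (forall s, continuous f s) -> antiperiodic p f ->
  antiperiodic p (antiperiodic_primitive p f).
Proof.
intros Hf Hp t; unfold antiperiodic_primitive.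
replace (RInt f (t + p) (t + p + p)) with (- RInt f t (t + p)); [ring|].
pose proof (RInt_comp_lin f 1 p t (t + p)) as H.
rewrite !Rmult_1_l in H; rewrite <- H by apply ex_RInt_of_continuous, Hf.
transitivity (RInt (fun s => opp (f s)) t (t + p)).
- symmetry; apply (RInt_opp f), ex_RInt_of_continuous, Hf.
- apply RInt_ext; intros s _; unfold scal, opp; simpl; unfold mult; simpl.
  now rewrite !Rmult_1_l, Hp.
Qed.

Lemma antiperiodic_primitive_bound (p : R) (f : R -> R) (M t : R) :
  0 <= p -> (forall s, continuous f s) -> (forall s, Rabs (f s) <= M) ->
  Rabs (antiperiodic_primitive p f t) <= p / 2 * M.
Proof.
intros Hp Hf HM; unfold antiperiodic_primitive.
assert (H : Rabs (RInt f t (t + p)) <= (t + p - t) * M).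
{ apply abs_RInt_le_const; auto; [lra | now apply ex_RInt_of_continuous]. }
rewrite Rabs_mult, Rabs_Ropp, Rabs_pos_eq; lra.
Qed.

Lemma antiperiodic_primitive_minus (p : R) (f g : R -> R) (t : R) :
  (forall s, continuous f s) -> (forall s, continuous g s) ->
  antiperiodic_primitive p f t - antiperiodic_primitive p g t =
  antiperiodic_primitive p (fun s => f s - g s) t.
Proof.
intros Hf Hg; unfold antiperiodic_primitive.
pose proof (RInt_minus f g t (t + p)
  (ex_RInt_of_continuous _ _ _ Hf) (ex_RInt_of_continuous _ _ _ Hg)) as H.
unfold minus, plus, opp in H; simpl in H; unfold Rminus; rewrite H; ring.
Qed.

(** * The differential equation *)

Lemma is_solution_of_is_derive (F : R -> R -> R) (x : R -> R) :
  (forall t, is_derive x t (F t (x t))) -> is_solution F x.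
Proof.
intros Hx t _.
pose proof (proj2 (derivable_pt_lim_D_in x (fun s => F s (x s)) t)
  (proj1 (is_derive_Reals _ _ _) (Hx t))) as H.
intros e He; destruct (H e He) as [d [Hd Hl]].
exists d; split; [exact Hd|]; intros s [[_ Hs] Hd'].
apply Hl; split; [split; [exact I | exact Hs] | exact Hd'].
Qed.

(** Shifting time by [PI] changes the sign of both [sin t] and [y t]: the
    argument of [h] only changes sign, which evenness absorbs, and the sign of
    the factor [sin t] in front remains. *)
Lemma antiperiodic_rhs (eps a : R) (h y : R -> R) :
  even_function h -> antiperiodic PI y ->
  antiperiodic PI (fun s => rhs eps a h s (y s)).
Proof.
intros Hh Hy t; unfold rhs.
rewrite Hy, neg_sin.
replace (- y t + a * - sin t) with (- (y t + a * sin t)) by ring.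
rewrite Hh; ring.
Qed.

Theorem proposition1 (eps a : R) (heps : 0 < eps) (ha : 0 < a)
  (h : R -> R) (hC3 : class_C 3 h) (heven : even_function h)
  (r : R) (hr : 0 < r)
  (M0 M1 : R)
  (hM0 : is_max_on (abs_le (r + a)) (fun z => Rabs (h z)) M0)
  (hM1 : is_max_on (abs_le (r + a)) (fun z => Rabs (Derive h z)) M1)
  (hbound : eps * PI / 2 * M0 <= r)
  (hcontr : eps * PI / 2 * M1 < 1) :
  exists x : R -> R,
    is_periodic_solution (rhs eps a h) (2 * PI) x /\
    x 0 = - x PI /\
    exists m : R,
      is_max_on (closed_itv 0 (2 * PI)) (fun t => Rabs (x t)) m /\
      m <= eps * PI / 2 * M0.
Proof.
destruct hM0 as [[z0 [_ Ez0]] ub0]; destruct hM1 as [[z1 [_ Ez1]] ub1].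
assert (M0pos : 0 <= M0) by (rewrite <- Ez0; apply Rabs_pos).
assert (M1pos : 0 <= M1) by (rewrite <- Ez1; apply Rabs_pos).
pose proof PI_RGT_0 as HPI.
assert (dh : forall z, is_derive h z (Derive h z)).
{ intros z; apply Derive_correct; exact (proj1 hC3 1%nat ltac:(lia) z). }
assert (ch : forall z, continuous h z).
{ intros z; apply (ex_derive_continuous (V := R_NormedModule)); eexists; apply dh. }
set (B := eps * PI / 2 * M0) in *.
set (K := eps * M0).
set (f := fun (y : R -> R) s => rhs eps a h s (y s)).
set (D := fun y => (forall t, Rabs (y t) <= B) /\ antiperiodic PI y /\ lipschitz K y).
assert (sin_le : forall s, Rabs (sin s) <= 1).
{ intros s; apply Rabs_le; pose proof (SIN_bound s); lra. }
(* Functions of [D] keep the argument of [h] in the region where [M0] and [M1]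
   bound [h] and its derivative. *)
assert (arg : forall y, D y -> forall s, abs_le (r + a) (y s + a * sin s)).
{ intros y [By _] s; unfold abs_le.
  apply Rle_trans with (1 := Rabs_triang _ _).
  rewrite Rabs_mult, (Rabs_pos_eq a) by lra.
  pose proof (By s); pose proof (Rmult_le_compat_l a _ _ (Rlt_le _ _ ha) (sin_le s)); lra. }
assert (cf : forall y, D y -> forall s, continuous (f y) s).
{ intros y [_ [_ Ly]] s; unfold f, rhs.
  apply (continuous_mult (fun s => - eps * sin s) (fun s => h (y s + a * sin s))).
  - apply (ex_derive_continuous (V := R_NormedModule)); auto_derive; auto.
  - apply (continuous_comp (fun s => y s + a * sin s) h); [|apply ch].
    apply (continuous_plus y (fun s => a * sin s)).
    + now apply lipschitz_continuous with K.
    + apply (ex_derive_continuous (V := R_NormedModule)); auto_derive; auto. }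
assert (weight : forall s c d, Rabs c <= d -> Rabs (- eps * sin s * c) <= eps * d).
{ intros s c d Hc; rewrite !Rabs_mult, Rabs_Ropp, (Rabs_pos_eq eps) by lra.
  rewrite Rmult_assoc; apply Rmult_le_compat_l; [lra|].
  rewrite <- (Rmult_1_l d).
  apply Rmult_le_compat; auto using Rabs_pos. }
assert (bf : forall y, D y -> forall s, Rabs (f y s) <= K).
{ intros y Dy s; apply weight; exact (ub0 _ (arg y Dy s)). }
assert (lip : forall y z, D y -> D z -> forall s,
  Rabs (f y s - f z s) <= eps * (M1 * Rabs (y s - z s))).
{ intros y z Dy Dz s; unfold f, rhs; rewrite <- Rmult_minus_distr_l.
  apply weight.
  replace (y s - z s) with (y s + a * sin s - (z s + a * sin s)) by ring.
  pose proof (proj1 (Rabs_le_between _ _) (arg y Dy s)).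
  pose proof (proj1 (Rabs_le_between _ _) (arg z Dz s)).
  apply lipschitz_of_derive_bound with (Derive h); [auto|].
  intros x Hx; apply ub1, Rabs_le; revert Hx.
  apply Rmin_case; apply Rmax_case; lra. }
assert (af : forall y, D y -> antiperiodic PI (f y)).
{ intros y [_ [Ay _]]; now apply antiperiodic_rhs. }
destruct (uniform_contraction_fixed_point R D
  (fun y => antiperiodic_primitive PI (f y)) (eps * PI / 2 * M1) B (fun _ => 0))
  as [x [Dx Tx]].
- split; [|exact hcontr].
  apply Rmult_le_pos; [|exact M1pos]; pose proof (Rmult_lt_0_compat _ _ heps HPI); lra.
- intros y z d Dy Dz Hd t.
  rewrite antiperiodic_primitive_minus by auto.
  replace (eps * PI / 2 * M1 * d) with (PI / 2 * (eps * (M1 * d))) by lra.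
  apply antiperiodic_primitive_bound; [lra | |].
  + intros s; apply (continuous_minus (f y) (f z)); auto.
  + intros s; apply Rle_trans with (1 := lip y z Dy Dz s).
    apply Rmult_le_compat_l; [lra|]; apply Rmult_le_compat_l; auto.
- repeat split.
  + intros _; rewrite Rabs_R0; unfold B.
    apply Rmult_le_pos; auto; pose proof (Rmult_lt_0_compat _ _ heps HPI); lra.
  + intros _; ring.
  + intros s t; rewrite Rminus_0_r, Rabs_R0; unfold K.
    repeat apply Rmult_le_pos; auto using Rabs_pos; lra.
- intros y Dy; repeat split.
  + intros t.
    replace B with (PI / 2 * K) by (unfold B, K; lra).
    apply antiperiodic_primitive_bound; auto; lra.
  + apply antiperiodic_antiperiodic_primitive; auto.
  + intros s t; apply lipschitz_of_derive_bound with (f y); auto.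
    intros v _; apply is_derive_antiperiodic_primitive; auto.
- intros y Dy; apply Dy.
- intros u l Du Hl; repeat split.
  + intros t; rewrite <- (Rminus_0_r (l t)).
    apply (is_lim_seq_abs_le _ _ _ _ (Hl t)); intros n.
    rewrite Rminus_0_r; apply (Du n).
  + apply (antiperiodic_lim _ u l); [intros n; apply (Du n) | exact Hl].
  + apply (lipschitz_lim _ u l); [intros n; apply (Du n) | exact Hl].
- pose proof Dx as [Bx [Ax Lx]].
  exists x; repeat split.
  + apply is_solution_of_is_derive; intros t.
    apply (is_derive_ext (antiperiodic_primitive PI (f x))); [exact Tx|].
    apply (is_derive_antiperiodic_primitive PI (f x)); auto.
  + intros t _; replace (t + 2 * PI) with (t + PI + PI) by ring.
    rewrite !Ax; ring.
  + pose proof (Ax 0) as H; rewrite Rplus_0_l in H; lra.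
  + destruct (is_max_on_itv_ex 0 (2 * PI) x) as [m Hm]; [lra | |].
    * intros t _; now apply lipschitz_continuous with K.
    * exists m; split; [exact Hm|].
      destruct Hm as [[t [_ <-]] _]; apply Bx.
Qed.
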